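(* Let $X$ and $Y$ be non-negative random variables with distributions $F$ and $G$ respectively, whose supports are $\mathbb{R}_+=[0,\infty)$. Write $X_1:=X$, $X_2:=Y$, and assume that for both $(i,j)\in\{(1,2),(2,1)\}$ there is some large enough $x_0>0$ such that $$\limsup_{x\to\infty}\ \sup_{x_0\le t\le x}\ \frac{\mathbf{P}[X_j>x-t\mid X_i=t]}{\mathbf{P}[X_j>x-t]}<\infty .$$ Let $F_{X\vee Y}$ denote the distribution of $X\vee Y=\max\{X,Y\}$. Then: 1. If $F\in\mathcal{P_D}$ and $G\in\mathcal{P_D}$, then $F_{X\vee Y}\in\mathcal{P_D}$. 2. If $F\in\mathcal{OL}$ and $G\in\mathcal{OL}$, then $F_{X\vee Y}\in\mathcal{OL}$. 3. If $F\in\mathcal{OT}$ and $G\in\mathcal{OT}$, then $F_{X\vee Y}\in\mathcal{OT}$. 4. If $F\in\mathcal{L}$ and $G\in\mathcal{L}$, then $F_{X\vee Y}\in\mathcal{L}$. 5. If $F\in\mathcal{T}$ and $G\in\mathcal{T}$, then $F_{X\vee Y}\in\mathcal{T}$.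
   Context: For a distribution $F$, $\overline F(x)=1-F(x)$ denotes its tail; all distributions satisfy $\overline F(x)>0$ for every $x\ge 0$. The conditional probability $\mathbf{P}[X_j>\cdot\mid X_i=t]$ is taken from a regular conditional distribution of $X_j$ given $X_i$. Classes of distributions: - $F\in\mathcal{P_D}$ (positively decreasing) if $\limsup_{x\to\infty}\overline F(vx)/\overline F(x)<1$ for some $v>1$. - $F\in\mathcal{OL}$ (generalized long-tailed) if $\limsup_{x\to\infty}\overline F(x-t)/\overline F(x)<\infty$ for every $t\neq 0$. - $F\in\mathcal{L}$ (long-tailed) if $\lim_{x\to\infty}\overline F(x-y)/\overline F(x)=1$ for every $y\ne 0$. - $\mathcal{OT}:=\mathcal{OL}\cap\mathcal{P_D}$ and $\mathcal{T}:=\mathcal{L}\cap\mathcal{P_D}$. *)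

(* Defs.v *)
From HB Require Import structures.
From mathcomp Require Import all_boot all_order all_algebra.
From mathcomp Require Import all_classical all_reals all_analysis.

Set Implicit Arguments.
Unset Strict Implicit.
Unset Printing Implicit Defensive.

Import Order.TTheory GRing.Theory Num.Theory.
Import numFieldNormedType.Exports.

Local Open Scope classical_set_scope.
Local Open Scope ring_scope.
Local Open Scope ereal_scope.

(* A distribution on the real line is represented by its law, a Borel
   probability measure F; its distribution function is x |-> F `]-oo, x]. *)
Definition tail (R : realType) (F : probability R R) (x : R) : \bar R :=
  1 - F `]-oo, x]%classic.

(* Standing assumption on all distributions. It is part of each class below, so
   that no quotient there has a zero denominator (in \bar R, 0^-1 = +oo). *)
Definition positive_tail (R : realType) (F : probability R R) : Prop :=
  forall x : R, (0 <= x)%R -> 0 < tail F x.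

Definition class_PD (R : realType) (F : probability R R) : Prop :=
  positive_tail F /\
  exists2 v : R, (1 < v)%R &
    limf_esup (fun x : R => tail F (v * x)%R / tail F x) +oo%R < 1.

Definition class_OL (R : realType) (F : probability R R) : Prop :=
  positive_tail F /\
  forall t : R, t != 0%R ->
    limf_esup (fun x : R => tail F (x - t)%R / tail F x) +oo%R < +oo.

Definition class_L (R : realType) (F : probability R R) : Prop :=
  positive_tail F /\
  forall y : R, y != 0%R ->
    tail F (x - y)%R / tail F x @[x --> +oo%R] --> (1 : \bar R).

Definition class_OT (R : realType) (F : probability R R) : Prop :=
  class_OL F /\ class_PD F.

Definition class_T (R : realType) (F : probability R R) : Prop :=
  class_L F /\ class_PD F.

(* Topological support: points all of whose open neighbourhoods are charged. *)
Definition law_support (R : realType) (F : probability R R) : set R :=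
  [set x | forall U : set R, open U -> U x -> 0 < F U].

(* k t B is P[V \in B | U = t]. *)
Definition regular_conditional_distribution (d : measure_display)
    (T : measurableType d) (R : realType) (P : probability T R)
    (U V : {RV P >-> R}) (k : R.-pker R ~> R) : Prop :=
  forall A B : set R, measurable A -> measurable B ->
    P (U @^-1` A `&` V @^-1` B) = \int[distribution P U]_(t in A) k t B.

(* k is the chosen version of the conditional distribution of V given U. *)
Definition bounded_conditional_tail (d : measure_display)
    (T : measurableType d) (R : realType) (P : probability T R)
    (V : {RV P >-> R}) (k : R.-pker R ~> R) : Prop :=
  exists2 x0 : R, (0 < x0)%R &
    limf_esup (fun x : R =>
      ereal_sup [set k t `](x - t)%R, +oo[%classic / ccdf V (x - t)%R | t in `[x0, x]%classic])
      +oo%R < +oo.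

(* Main.v *)
(* Applying the dependence hypothesis at level x + t to all t > x gives
   P[X > x, Y > x] <= C P[X > x] P[Y > x] for large x, which is negligible with
   respect to P[X > x] + P[Y > x].  Hence the tail of the maximum is equivalent
   to the sum of the tails of X and Y, and each class passes from two tails to
   their sum and is stable under tail equivalence. *)
Require Import Defs.
From HB Require Import structures.
From mathcomp Require Import all_boot all_order all_algebra.
From mathcomp Require Import all_classical all_reals all_analysis.
From mathcomp Require Import lra.

Set Implicit Arguments.
Unset Strict Implicit.
Unset Printing Implicit Defensive.

Import Order.TTheory GRing.Theory Num.Theory.
Import numFieldNormedType.Exports.

Local Open Scope classical_set_scope.
Local Open Scope ring_scope.

(** * Limits superior and tail ratios as eventual inequalities *)

Lemma limf_esup_ltP (R : realType) (f : R -> \bar R) (F : set_system R)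
    (FF : Filter F) (a : \bar R) : (-oo < a)%E ->
  (limf_esup f F < a)%E <->
  exists2 c : R, (c%:E < a)%E & \forall x \near F, (f x <= c%:E)%E.
Proof.
move=> a_gtNy; split.
- move=> /ereal_inf_lt[_ [A FA <-]] supA.
  (* A finite supremum is its own witness. If it is [-oo], any real below [a] will do: [r - 1] when
     [a] is a real [r], and [0] when [a] is [+oo]. *)
  have [c ca supc] : exists2 c : R, (c%:E < a)%E & (ereal_sup (f @` A) <= c%:E)%E.
    case: (ereal_sup (f @` A)) supA => [s sa | |_].
    + by exists s.
    + by rewrite ltNge leey.
    + case: a a_gtNy => [r _|_|//].
        by exists (r - 1); [rewrite lte_fin; lra|exact: leNye].
      by exists 0; [exact: ltry|exact: leNye].
  exists c => //; apply: filterS FA => x Ax.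
  by apply: le_trans supc; apply: ereal_sup_ubound; exists x.
- move=> [c ca fc]; apply: le_lt_trans ca.
  apply: ge_ereal_inf.
  exists (ereal_sup (f @` [set x | (f x <= c%:E)%E])).
    by exists [set x | (f x <= c%:E)%E].
  by apply: ge_ereal_sup => _ [x /= fxc <-].
Qed.

Definition rtail (R : realType) (F : probability R R) (x : R) : R :=
  fine (tail F x).

Lemma tail_ray (R : realType) (F : probability R R) (x : R) :
  tail F x = F `]x, +oo[%classic.
Proof. by rewrite /tail -probability_setC// setCitvl. Qed.

Lemma rtailE (R : realType) (F : probability R R) (x : R) :
  tail F x = (rtail F x)%:E.
Proof. by rewrite /rtail tail_ray fineK// fin_num_measure. Qed.

Lemma rtail_ge0 (R : realType) (F : probability R R) (x : R) : 0 <= rtail F x.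
Proof. by rewrite -lee_fin -rtailE tail_ray measure_ge0. Qed.

Lemma rtail_nonincreasing (R : realType) (F : probability R R) (x y : R) :
  x <= y -> rtail F y <= rtail F x.
Proof.
move=> xy; rewrite -lee_fin -!rtailE !tail_ray le_measure ?inE//.
by apply: subset_itv => //; rewrite bnd_simp.
Qed.

Lemma positive_tailP (R : realType) (F : probability R R) :
  positive_tail F <-> forall x : R, 0 <= x -> 0 < rtail F x.
Proof. by split=> F0 x /F0; rewrite rtailE lte_fin. Qed.

Lemma tail_ratioE (R : realType) (F : probability R R) (x y : R) :
  0 < rtail F x -> (tail F y / tail F x)%E = (rtail F y / rtail F x)%:E.
Proof. by move=> Fx; rewrite !rtailE inver gt_eqF. Qed.

Lemma tail_ratio_le (R : realType) (F : probability R R) (x y c : R) :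
  0 < rtail F x ->
  (tail F y / tail F x <= c%:E)%E = (rtail F y <= c * rtail F x).
Proof. by move=> Fx; rewrite tail_ratioE// lee_fin ler_pdivrMr. Qed.

(** The denominator is positive for [x >= 0], hence eventually, and can be cleared. Taking [a = 1]
    serves [class_PD], and [a = +oo] serves [class_OL]. *)
Lemma limsup_tail_ratio_ltP (R : realType) (F : probability R R) (u : R -> R)
    (a : \bar R) : (-oo < a)%E -> positive_tail F ->
  (limf_esup (fun x => tail F (u x) / tail F x)%E +oo%R < a)%E <->
  exists2 c : R, (c%:E < a)%E &
    \forall x \near +oo, rtail F (u x) <= c * rtail F x.
Proof.
move=> a_gtNy /positive_tailP F0; rewrite limf_esup_ltP//.
have E c : (\forall x \near +oo, (tail F (u x) / tail F x <= c%:E)%E) <->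
    \forall x \near +oo, rtail F (u x) <= c * rtail F x.
  split; apply: filterS2 (nbhs_pinfty_ge (num_real 0)) => x x0;
  by rewrite tail_ratio_le ?F0.
by split=> -[c ca /E]; exists c.
Qed.

(** For [x >= 0] the quotient is a finite real, so its convergence to 1 is an epsilon bound, which
    is multiplied by the positive tail at [x]. *)
Lemma class_LP (R : realType) (F : probability R R) :
  class_L F <-> positive_tail F /\ forall y, y != 0 -> forall e, 0 < e ->
    \forall x \near +oo,
      (1 - e) * rtail F x <= rtail F (x - y) <= (1 + e) * rtail F x.
Proof.
split=> -[F0 FL]; split=> // y /FL {}FL; have /positive_tailP {}F0 := F0.
- move=> e e0; have /fine_cvgP[_ /cvgrPdist_le/(_ _ e0)] := FL.
  apply: filterS2 (nbhs_pinfty_ge (num_real 0)) => x x0 /=.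
  by rewrite tail_ratioE ?F0//= ler_distlC ler_pdivlMr ?F0// ler_pdivrMr ?F0.
- apply/fine_cvgP; split.
    apply: filterS (nbhs_pinfty_ge (num_real 0)) => x x0.
    by rewrite tail_ratioE// F0.
  apply/cvgrPdist_le => e /FL.
  apply: filterS2 (nbhs_pinfty_ge (num_real 0)) => x x0 /=.
  by rewrite tail_ratioE ?F0//= ler_distlC ler_pdivlMr ?F0// ler_pdivrMr ?F0.
Unshelve. all: by end_near. Qed.

(** * Closure of the classes under asymptotic sums of tails *)

Definition asymptotic_tail_sum (R : realType) (F G H : probability R R) : Prop :=
  (forall x, [/\ rtail F x <= rtail H x, rtail G x <= rtail H x &
                rtail H x <= rtail F x + rtail G x]) /\
  (positive_tail F -> positive_tail G -> forall e, 0 < e ->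
     \forall x \near +oo, (1 - e) * (rtail F x + rtail G x) <= rtail H x).

Lemma asymptotic_tail_sum_positive {R : realType} {F G H : probability R R} :
  asymptotic_tail_sum F G H -> positive_tail F -> positive_tail H.
Proof.
move=> [FGH _] /positive_tailP F0; apply/positive_tailP => x /F0 Fx.
by have [FH _ _] := FGH x; apply: lt_le_trans FH.
Qed.

Lemma asymptotic_tail_sum_PD (R : realType) (F G H : probability R R) :
  asymptotic_tail_sum F G H -> class_PD F -> class_PD G -> class_PD H.
Proof.
move=> FGH [F0 [v v1 /limsup_tail_ratio_ltP-/(_ (ltNyr 1) F0)[c c1 Fc]]].
move=> [G0 [w w1 /limsup_tail_ratio_ltP-/(_ (ltNyr 1) G0)[b b1 Gb]]].
have H0 := asymptotic_tail_sum_positive FGH F0; split=> //.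
(* Tails are nonincreasing, so for [x >= 0] the larger factor preserves both decay bounds. *)
exists (Num.max v w); first by rewrite lt_max v1.
apply/(limsup_tail_ratio_ltP _ (ltNyr 1) H0).
move: FGH => [FGH /(_ F0 G0) asym].
(* Including 0 gives the common ratio a sign, so inequalities may be multiplied by it. *)
pose a := Num.max 0 (Num.max c b).
have a0 : 0 <= a by rewrite le_max lexx.
have ca : c <= a by rewrite !le_max lexx orbT.
have ba : b <= a by rewrite !le_max lexx !orbT.
have a1 : a < 1 by rewrite !gt_max ltr01 -!lte_fin c1 b1.
(* With this error, [1 - e = (1 + a) / 2]; dividing [a] by it gives the ratio [2 * a / (1 + a)],
   below 1 because [a < 1]. *)
have e0 : 0 < (1 - a) / 2 by lra.
exists (2 * a / (1 + a)).
  by rewrite lte_fin ltr_pdivrMr; lra.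
near=> x.
have x0 : 0 <= x by near: x; exact: nbhs_pinfty_ge (num_real 0).
have Fx : rtail F (v * x) <= c * rtail F x by near: x.
have Gx : rtail G (w * x) <= b * rtail G x by near: x.
have Hx : (1 - (1 - a) / 2) * (rtail F x + rtail G x) <= rtail H x.
  by near: x; exact: asym.
have [_ _ Hle] := FGH (Num.max v w * x).
have Fle : rtail F (Num.max v w * x) <= a * rtail F x.
  apply: le_trans (le_trans _ Fx) _.
    by apply: rtail_nonincreasing; rewrite ler_wpM2r// le_max lexx.
  by rewrite ler_wpM2r// rtail_ge0.
have Gle : rtail G (Num.max v w * x) <= a * rtail G x.
  apply: le_trans (le_trans _ Gx) _.
    by apply: rtail_nonincreasing; rewrite ler_wpM2r// le_max lexx orbT.
  by rewrite ler_wpM2r// rtail_ge0.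
rewrite mulrAC ler_pdivlMr; last lra.
have : a * ((1 - (1 - a) / 2) * (rtail F x + rtail G x)) <= a * rtail H x.
  exact: ler_wpM2l.
have : (1 + a) * rtail H (Num.max v w * x) <=
    (1 + a) * (a * rtail F x + a * rtail G x) by rewrite ler_wpM2l; lra.
lra.
Unshelve. all: by end_near. Qed.

Lemma asymptotic_tail_sum_OL (R : realType) (F G H : probability R R) :
  asymptotic_tail_sum F G H -> class_OL F -> class_OL G -> class_OL H.
Proof.
move=> FGH [F0 FOL] [G0 GOL].
have H0 := asymptotic_tail_sum_positive FGH F0; split=> // t t0.
have /limsup_tail_ratio_ltP-/(_ isT F0)[c _ Fc] := FOL t t0.
have /limsup_tail_ratio_ltP-/(_ isT G0)[b _ Gb] := GOL t t0.
apply/(limsup_tail_ratio_ltP (a := +oo%E) _ isT H0).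
(* The tails of [F] and [G] are each at most that of [H], so the two constants add up. Their signs
   are unknown, hence the absolute values. *)
exists (`|c| + `|b|); first exact: ltry.
near=> x.
have Fx : rtail F (x - t) <= c * rtail F x by near: x.
have Gx : rtail G (x - t) <= b * rtail G x by near: x.
move: FGH => [FGH _].
have [FHx GHx _] := FGH x; have [_ _ Hle] := FGH (x - t).
have : c * rtail F x <= `|c| * rtail H x.
  by rewrite (le_trans (ler_norm _))// normrM (ger0_norm (rtail_ge0 _ _)) ler_wpM2l.
have : b * rtail G x <= `|b| * rtail H x.
  by rewrite (le_trans (ler_norm _))// normrM (ger0_norm (rtail_ge0 _ _)) ler_wpM2l.
lra.
Unshelve. all: by end_near. Qed.

Lemma asymptotic_tail_sum_L (R : realType) (F G H : probability R R) :
  asymptotic_tail_sum F G H -> class_L F -> class_L G -> class_L H.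
Proof.
move=> FGH /class_LP[F0 FL] /class_LP[G0 GL]; apply/class_LP.
split; first exact: asymptotic_tail_sum_positive FGH F0.
move: FGH => [FGH /(_ F0 G0) asym] y y0 e e0.
(* Small enough that [1 - e <= (1 - q) ^+ 2] and [1 + q <= (1 + e) * (1 - q)], the two losses met at
   the end. *)
pose q := Num.min e 1 / 4.
have q0 : 0 < q by rewrite divr_gt0// lt_min e0 ltr01.
have qe : 4 * q <= e by rewrite /q mulrC divfK// ge_min lexx.
have q1 : 4 * q <= 1 by rewrite /q mulrC divfK// ge_min lexx orbT.
have shift : \forall x \near +oo,
    (1 - q) * (rtail F (x - y) + rtail G (x - y)) <= rtail H (x - y).
  exact: (cvg_addrr (- y) (asym q q0)).
near=> x.
have /andP[Fl Fr] :
    (1 - q) * rtail F x <= rtail F (x - y) <= (1 + q) * rtail F x.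
  by near: x; exact: FL.
have /andP[Gl Gr] :
    (1 - q) * rtail G x <= rtail G (x - y) <= (1 + q) * rtail G x.
  by near: x; exact: GL.
have Hx : (1 - q) * (rtail F x + rtail G x) <= rtail H x.
  by near: x; exact: asym.
have Hxy : (1 - q) * (rtail F (x - y) + rtail G (x - y)) <= rtail H (x - y).
  by near: x.
have [_ _ Hle] := FGH x; have [_ _ Hley] := FGH (x - y).
have H_ge0 := rtail_ge0 H x.
have S_ge0 : 0 <= rtail F x + rtail G x by rewrite addr_ge0 ?rtail_ge0.
move: Fl Fr Gl Gr Hx Hxy Hle Hley H_ge0 S_ge0.
set f := rtail F x; set g := rtail G x; set h := rtail H x.
set f' := rtail F _; set g' := rtail G _; set h' := rtail H _.
move=> Fl Fr Gl Gr Hx Hxy Hle Hley H_ge0 S_ge0.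
apply/andP; split.
(* Lower bound: one factor [1 - q] comes from replacing [h'] by [f' + g'], the other from the shift
   by [y]. *)
- have lowS : (1 - q) * ((1 - q) * (f + g)) <= (1 - q) * (f' + g').
    by rewrite ler_wpM2l; lra.
  have : (1 - q) ^+ 2 * h <= (1 - q) ^+ 2 * (f + g) by rewrite ler_wpM2l// sqr_ge0.
  have : (1 - e) * h <= (1 - q) ^+ 2 * h by rewrite ler_wpM2r//; nra.
  nra.
(* Upper bound: the shift costs [1 + q], and returning from [f + g] to [h] costs a division by
   [1 - q]. *)
- have : (1 + e) * ((1 - q) * (f + g)) <= (1 + e) * h by rewrite ler_wpM2l; lra.
  have : (1 + q) * (f + g) <= (1 + e) * (1 - q) * (f + g).
    by rewrite ler_wpM2r//; nra.
  lra.
Unshelve. all: by end_near. Qed.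

(** * Joint tail and tail of the maximum *)

Lemma joint_tail_le (R : realType) (d : measure_display) (T : measurableType d)
    (P : probability T R) (X Y : {RV P >-> R}) (k : R.-pker R ~> R) :
  regular_conditional_distribution X Y k -> bounded_conditional_tail Y k ->
  positive_tail (distribution P Y) ->
  exists C : R, \forall x \near +oo,
    (P (X @^-1` `]x, +oo[%classic `&` Y @^-1` `]x, +oo[%classic) <=
     (C * (rtail (distribution P X) x * rtail (distribution P Y) x))%:E)%E.
Proof.
move=> kP [x0 x0_gt0 /limf_esup_ltP-/(_ isT)[C _ Cdep]] Y0.
exists C.
(* The level [x + t] varies with [t], so an explicit threshold [M] is extracted: once [x > M], it is
   passed for all [t > x] at once. *)
have [M [_ Mdep]] := Cdep.
near=> x.
have x_ge0 : 0 <= x by near: x; exact: nbhs_pinfty_ge (num_real 0).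
have x0x : x0 <= x by near: x; exact: nbhs_pinfty_ge (num_real _).
have Mx : M < x by near: x; exact: nbhs_pinfty_gt (num_real _).
have Yx : 0 < rtail (distribution P Y) x by move/positive_tailP: Y0; exact.
have kle t : x < t -> (k t `]x, +oo[%classic <= (C * rtail (distribution P Y) x)%:E)%E.
  move=> xt.
  have : (k t `]x, +oo[%classic / ccdf Y x <= C%:E)%E.
    apply: le_trans (Mdep (x + t) _); last by lra.
    apply: ereal_sup_ubound; exists t; last by rewrite addrK.
    by rewrite /= in_itv/=; apply/andP; split; lra.
  by rewrite /ccdf -tail_ray rtailE inver gt_eqF// lee_pdivrMr.
(* Disintegrating along [X] turns the joint tail into an integral over [t > x], where [kle] bounds
   the integrand by a constant. *)
rewrite kP//.
apply: (@le_trans _ _ (\int[distribution P X]_(t in `]x, +oo[%classic)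
    cst (C * rtail (distribution P Y) x)%:E t)%E).
  apply: ge0_le_integral => //=.
  - apply: (measurable_funS measurableT) => //; exact: measurable_kernel.
  - by move=> t; rewrite in_itv/= andbT; exact: kle.
have Xtail : distribution P X `]x, +oo[%classic = (rtail (distribution P X) x)%:E.
  by rewrite -rtailE tail_ray.
by rewrite integral_cst// [X in (_ * X)%E]Xtail -EFinM lee_fin mulrAC mulrA.
Unshelve. all: by end_near. Qed.

Lemma tail_max (R : realType) (d : measure_display) (T : measurableType d)
    (P : probability T R) (X Y : {RV P >-> R}) (x : R) :
  tail (distribution P (measurable_realfun.max_mfun X Y)) x =
  P (X @^-1` `]x, +oo[%classic `|` Y @^-1` `]x, +oo[%classic).
Proof.
rewrite tail_ray /distribution /pushforward; congr (P _).
apply/seteqP; split => w /=; rewrite !in_itv/= !andbT lt_max;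
  by move=> /orP.
Qed.

Lemma asymptotic_tail_sum_max (R : realType) (d : measure_display)
    (T : measurableType d) (P : probability T R) (X Y : {RV P >-> R})
    (k : R.-pker R ~> R) :
  regular_conditional_distribution X Y k -> bounded_conditional_tail Y k ->
  asymptotic_tail_sum (distribution P X) (distribution P Y)
    (distribution P (measurable_realfun.max_mfun X Y)).
Proof.
move=> kP dep; set H := distribution P (measurable_realfun.max_mfun X Y).
have mray (Z : {RV P >-> R}) x : measurable (Z @^-1` `]x, +oo[%classic).
  by rewrite -[_ @^-1` _]setTI; exact: measurable_funP.
have tailE (Z : {RV P >-> R}) x :
    (rtail (distribution P Z) x)%:E = P (Z @^-1` `]x, +oo[%classic).
  by rewrite -rtailE tail_ray.
have maxE x : (rtail H x)%:E =
    P (X @^-1` `]x, +oo[%classic `|` Y @^-1` `]x, +oo[%classic).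
  by rewrite -rtailE tail_max.
split=> [x|_ Y0 e e0].
  rewrite -!lee_fin EFinD maxE !tailE; split.
  - by rewrite le_measure ?inE//; exact: measurableU.
  - by rewrite le_measure ?inE//; exact: measurableU.
  - exact: measureU2.
have [C XYC] := joint_tail_le kP dep Y0.
(* The tail of [X] tends to 0, so the joint tail will be at most [e] times the tail of [Y]. The
   [+ 1] below keeps the divisor positive when [C = 0]. *)
have X_small : \forall x \near +oo, `|C| * rtail (distribution P X) x <= e.
  have /fine_cvgP[_ /cvgrPdist_le/(_ (e / (`|C| + 1)))] := cvg_ccdfy0 X.
  have C1 : 0 < `|C| + 1 by rewrite ltr_wpDl.
  move=> /(_ (divr_gt0 e0 C1)); apply: filterS => x /=.
  rewrite sub0r normrN /ccdf -tail_ray rtailE/= ger0_norm ?rtail_ge0//.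
  rewrite ler_pdivlMr// mulrC; apply: le_trans.
  by rewrite ler_wpM2r ?rtail_ge0//; lra.
near=> x.
have XYx : (P (X @^-1` `]x, +oo[%classic `&` Y @^-1` `]x, +oo[%classic) <=
    (C * (rtail (distribution P X) x * rtail (distribution P Y) x))%:E)%E.
  by near: x.
have Xx : `|C| * rtail (distribution P X) x <= e by near: x.
(* Inclusion-exclusion for the two exceedance events, with the joint tail replaced by its upper
   bound. *)
have : (rtail (distribution P X) x + rtail (distribution P Y) x -
    C * (rtail (distribution P X) x * rtail (distribution P Y) x) <= rtail H x).
  rewrite -lee_fin EFinB EFinD maxE !tailE.
  rewrite measureUfinl ?ltey_eq ?fin_num_measure//.
  by rewrite leeB.
have := rtail_ge0 (distribution P X) x.
have := rtail_ge0 (distribution P Y) x.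
move: Xx; set f := rtail _ x; set g := rtail _ x => Cf g0 f0.
have : C * (f * g) <= e * g.
  by rewrite mulrA ler_wpM2r// (le_trans _ Cf)// ler_wpM2r// ler_norm.
have : 0 <= e * f by rewrite mulr_ge0// ltW.
lra.
Unshelve. all: by end_near. Qed.

Theorem theorem2p1 (R : realType) (d : measure_display) (T : measurableType d)
    (P : probability T R) (X Y : {RV P >-> R})
    (kYX kXY : R.-pker R ~> R)
    (X_ge0 : \forall w \ae P, 0 <= X w)
    (Y_ge0 : \forall w \ae P, 0 <= Y w)
    (suppX : law_support (distribution P X) = `[0, +oo[%classic)
    (suppY : law_support (distribution P Y) = `[0, +oo[%classic)
    (kYXP : regular_conditional_distribution X Y kYX)
    (kXYP : regular_conditional_distribution Y X kXY)
    (depYX : bounded_conditional_tail Y kYX)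
    (depXY : bounded_conditional_tail X kXY) :
  let F : probability R R := distribution P X in
  let G : probability R R := distribution P Y in
  let FmaxXY : probability R R := distribution P (measurable_realfun.max_mfun X Y) in
  [/\ class_PD F -> class_PD G -> class_PD FmaxXY,
      class_OL F -> class_OL G -> class_OL FmaxXY,
      class_OT F -> class_OT G -> class_OT FmaxXY,
      class_L F -> class_L G -> class_L FmaxXY
    & class_T F -> class_T G -> class_T FmaxXY].
Proof.
move=> F G FmaxXY.
have FGH := asymptotic_tail_sum_max kYXP depYX.
have PD := asymptotic_tail_sum_PD FGH.
have OL := asymptotic_tail_sum_OL FGH.
have L := asymptotic_tail_sum_L FGH.
split=> //.
- by move=> [FOL FPD] [GOL GPD]; split; [exact: OL|exact: PD].
- by move=> [FL FPD] [GL GPD]; split; [exact: L|exact: PD].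
Qed.
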